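(* Let $n$ be a sufficiently large even positive integer. Let $m,d \in \mathbb{N}$ with $d \leq m \leq n$, and let $\epsilon \in (0,1)$. If $d \geq 32\epsilon^{-2}\log n$ and $d \geq \log^2 n$, then with probability at least $1 - 4/n - 2/m^2$, the random binary matrix $M \in \mathbb{R}^{m \times n}$ with i.i.d. entries $M_{ij} \sim \mathrm{Ber}(d/m)$ satisfies the following, with $k = m/d^3$: (i) for all $j\in[n]$, $|N(j)| \le (1+\epsilon)d$, and for all $i\in[m]$, $|N'(i)|\le(1+\epsilon)(n/m)d$; (ii) for all $S\subseteq[n]$ with $|S|\le k$, $|N(S)|\ge(1-\epsilon)d|S|$; (iii) for all disjoint $S,T\subseteq[n]$ with $|S|,|T|\le k$, $|N(S)\cap N(T)|\le\frac{\sqrt d}{8}\max(|S|,|T|)$.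
   Context: For a binary matrix $M\in\{0,1\}^{m\times n}$ (viewed as a bipartite graph between equations $[m]$ and coordinates $[n]$), for $S\subseteq[n]$ let $N(S)=\{i\in[m]:\exists j\in S, M_{ij}=1\}$ (write $N(j)=N(\{j\})$), and for $E\subseteq[m]$ let $N'(E)=\{j\in[n]:\exists i\in E, M_{ij}=1\}$ (write $N'(i)=N'(\{i\})$). *)

(* Defs.v *)
From HB Require Import structures.
From mathcomp Require Import all_boot all_order all_algebra.
From mathcomp Require Import all_classical all_reals all_analysis.

Set Implicit Arguments.
Unset Strict Implicit.
Unset Printing Implicit Defensive.

Import Order.TTheory GRing.Theory Num.Theory.

Local Open Scope ring_scope.

(* A binary matrix is read as a bipartite graph between equations (rows) and
   coordinates (columns): eq_nbhd M S is N(S), coord_nbhd M E is N'(E). *)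
Definition eq_nbhd (m n : nat) (M : 'M[bool]_(m, n)) (S : {set 'I_n}) :
  {set 'I_m} := [set i : 'I_m | [exists j in S, M i j]]%SET.

Definition coord_nbhd (m n : nat) (M : 'M[bool]_(m, n)) (E : {set 'I_m}) :
  {set 'I_n} := [set j : 'I_n | [exists i in E, M i j]]%SET.

Section Properties.
Context {R : realType} {m n : nat}.
Implicit Type M : 'M[bool]_(m, n).

Definition degrees_bounded M (d : nat) (eps : R) : Prop :=
  (forall j : 'I_n, #|eq_nbhd M [set j]%SET|%:R <= (1 + eps) * d%:R) /\
  (forall i : 'I_m,
     #|coord_nbhd M [set i]%SET|%:R <= (1 + eps) * (n%:R / m%:R) * d%:R).

Definition expanding M (d : nat) (eps k : R) : Prop :=
  forall S : {set 'I_n}, #|S|%:R <= k ->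
    (1 - eps) * d%:R * #|S|%:R <= #|eq_nbhd M S|%:R.

Definition small_intersections M (d : nat) (k : R) : Prop :=
  forall S T : {set 'I_n}, [disjoint S & T] ->
    #|S|%:R <= k -> #|T|%:R <= k ->
    #|(eq_nbhd M S :&: eq_nbhd M T)%SET|%:R
      <= Num.sqrt (d%:R : R) / 8 * (maxn #|S| #|T|)%:R.

End Properties.

Local Open Scope classical_set_scope.

Section RandomMatrix.
Context {R : realType} {dT : measure_display} {T : measurableType dT}.
Variable P : probability T R.

Definition mutually_independent (I : finType) (dU : measure_display)
    (U : measurableType dU) (X : I -> {RV P >-> U}) : Prop :=
  forall (J : {set I}) (B : I -> set U),
    (forall i, i \in J -> measurable (B i)) ->
    P [set w | forall i, i \in J -> B i (X i w)]
      = (\prod_(i in J) P (X i @^-1` B i))%E.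

Definition iid_bernoulli (I : finType) (X : I -> {RV P >-> bool}) (p : R) :
    Prop :=
  mutually_independent X /\
  forall (i : I) (B : set bool), distribution P (X i) B = bernoulli_prob p B.

Definition random_matrix (m n : nat) (X : 'I_m * 'I_n -> {RV P >-> bool})
    (w : T) : 'M[bool]_(m, n) :=
  \matrix_(i, j) X (i, j) w.

End RandomMatrix.

(* Main.v *)
(* Under the law of M the rows are independent, so P[A(M)] is a finite weighted
   sum over matrices in which products over rows factor.  Each failure event is
   weighted by its Chernoff exponential, and the expected total weight bounds
   the failure probability.  With t = eps / 4, the inequality
   e^x <= 1 + x + x^2 for x <= 1/4 bounds the degree events by n^-6 each and the
   expansion event of S by n^(-4|S|).  For the intersection event of (S, T) the
   exponential base is d: as |S|, |T| <= m / d^3, the expected value of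
   d^|N(S) n N(T)| is at most e^max(|S|,|T|), whereas the threshold
   sqrt d / 8 * max(|S|,|T|) gains ln d * ln n / 8 per element because
   ln n <= sqrt d; once ln d >= 72 this yields n^(-4|S| - 4|T|).  The union
   bound uses that the sum of x^|S| over nonempty S is (1 + x)^n - 1 <= 2 n x.
   The condition ln d >= 72, implied by ln n >= e^36, is what fixes n0. *)
Require Import Defs.
From HB Require Import structures.
From mathcomp Require Import all_boot all_order all_algebra.
From mathcomp Require Import all_classical all_reals all_analysis.
From mathcomp Require Import ring lra.

Set Implicit Arguments.
Unset Strict Implicit.
Unset Printing Implicit Defensive.

Import Order.TTheory GRing.Theory Num.Theory.

Local Open Scope classical_set_scope.
Local Open Scope ring_scope.

(** * Expectation over independent coordinates with finite range *)

Section ProductMean.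
Context {R : realFieldType} {I K : finType}.
Implicit Types (w : K -> R) (G : {ffun I -> K} -> R).

(** When [w] sums to 1, this is the expectation of [G] over coordinates drawn independently from
    [w]. It serves at two levels: for the rows of the matrix, and for the entries of one row. *)
Definition prod_mean w G : R :=
  \sum_(f : {ffun I -> K}) (\prod_i w (f i)) * G f.

Lemma eq_prod_mean w G1 G2 : G1 =1 G2 -> prod_mean w G1 = prod_mean w G2.
Proof. by move=> G12; apply: eq_bigr => f _; rewrite G12. Qed.

(** Independence in finite form: expanding the product of sums by distributivity yields one term per
    function. *)
Lemma prod_mean_prod w (g : I -> K -> R) :
  prod_mean w (fun f => \prod_i g i (f i)) = \prod_i \sum_k w k * g i k.
Proof.
by rewrite bigA_distr_bigA; apply: eq_bigr => f _; rewrite big_split.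
Qed.

Lemma prod_mean1 w : \sum_k w k = 1 -> prod_mean w (fun=> 1) = 1.
Proof.
move=> w1; rewrite [LHS](_ : _ = prod_mean w (fun f => \prod_(i : I) 1)).
  rewrite (prod_mean_prod w (fun _ _ => 1)) big1// => i _.
  by rewrite -[RHS]w1; apply: eq_bigr => k _; rewrite mulr1.
by apply: eq_prod_mean => f; rewrite big1.
Qed.

Lemma prod_meanZ w c G : prod_mean w (fun f => c * G f) = c * prod_mean w G.
Proof. by rewrite [RHS]mulr_sumr; apply: eq_bigr => f _; rewrite mulrCA. Qed.

Lemma prod_meanB w G1 G2 :
  prod_mean w (fun f => G1 f - G2 f) = prod_mean w G1 - prod_mean w G2.
Proof. by rewrite -sumrB; apply: eq_bigr => f _; rewrite mulrBr. Qed.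

Lemma prod_meanD w G1 G2 :
  prod_mean w (fun f => G1 f + G2 f) = prod_mean w G1 + prod_mean w G2.
Proof. by rewrite -big_split; apply: eq_bigr => f _; rewrite mulrDr. Qed.

Lemma prod_mean_sum w (L : finType) (Q : pred L) (G : L -> {ffun I -> K} -> R) :
  prod_mean w (fun f => \sum_(l | Q l) G l f)
    = \sum_(l | Q l) prod_mean w (G l).
Proof.
rewrite [RHS]exchange_big; apply: eq_bigr => f _; exact: mulr_sumr.
Qed.

Lemma le_prod_mean w G1 G2 : (forall k, 0 <= w k) -> (forall f, G1 f <= G2 f) ->
  prod_mean w G1 <= prod_mean w G2.
Proof.
by move=> w0 G12; apply: ler_sum => f _; rewrite ler_wpM2l// prodr_ge0.
Qed.

End ProductMean.

(** * Law of a single row of Bernoulli entries *)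

Section RowLaw.
Context {R : realFieldType} {J : finType}.
Variable p : R.
Hypothesis p01 : 0 <= p <= 1.

Definition row_weight (r : {ffun J -> bool}) : R :=
  \prod_j bernoulli_pmf p (r j).

Lemma row_weight_ge0 r : 0 <= row_weight r.
Proof. by apply: prodr_ge0 => j _; exact: bernoulli_pmf_ge0. Qed.

Lemma sum_row_weight : \sum_r row_weight r = 1.
Proof.
rewrite -[RHS](@prod_mean1 _ J _ (bernoulli_pmf p)).
  by apply: eq_bigr => r _; rewrite mulr1.
by rewrite big_bool /bernoulli_pmf /= addrC subrK.
Qed.

Lemma row_mean_prod (g : J -> bool -> R) :
  \sum_r row_weight r * \prod_j g j (r j)
    = \prod_j (p * g j true + (1 - p) * g j false).
Proof.
rewrite -[LHS]/(prod_mean (bernoulli_pmf p) (fun r => \prod_j g j (r j))).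
by rewrite prod_mean_prod; apply: eq_bigr => j _; rewrite big_bool.
Qed.

(** The indicator is a product over all coordinates, with factor 1 outside [A], so its mean
    factors. *)
Lemma row_mean_entries (A : {set J}) :
  \sum_r row_weight r * ([forall j in A, r j])%:R = p ^+ #|A|.
Proof.
transitivity (\sum_r row_weight r * \prod_j (if j \in A then (r j)%:R else 1)).
  apply: eq_bigr => r _; congr (_ * _).
  rewrite -big_mkcond/=.
  case: (boolP [forall j in A, r j]) => [/forall_inP rA|].
    by rewrite big1// => j /rA ->.
  rewrite negb_forall_in => /exists_inP[j jA /negbTE rj].
  by rewrite (bigD1 j)//= rj mul0r.
rewrite (row_mean_prod (fun j b => if j \in A then b%:R else 1)).
rewrite -prodr_const [RHS]big_mkcond; apply: eq_bigr => j _.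
by case: ifP => _ /=; ring.
Qed.

Lemma row_mean_miss (A : {set J}) :
  \sum_r row_weight r * (~~ [exists j in A, r j])%:R = (1 - p) ^+ #|A|.
Proof.
transitivity
    (\sum_r row_weight r * \prod_j (if j \in A then (~~ r j)%:R else 1)).
  apply: eq_bigr => r _; congr (_ * _).
  rewrite -big_mkcond/= negb_exists_in.
  case: (boolP [forall j in A, ~~ r j]) => [/forall_inP rA|].
    by rewrite big1// => j /rA ->.
  rewrite negb_forall_in => /exists_inP[j jA /negbTE rj].
  by rewrite (bigD1 j)//= rj mul0r.
rewrite (row_mean_prod (fun j b => if j \in A then (~~ b)%:R else 1)).
rewrite -prodr_const [RHS]big_mkcond; apply: eq_bigr => j _.
by case: ifP => _ /=; ring.
Qed.

End RowLaw.

(** * Transfer from the probability space to a finite sum *)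

Section Law.
Context {R : realType} {m n : nat} {dT : measure_display}.
Context {T : measurableType dT} {P : probability T R}.
Variable X : 'I_m * 'I_n -> {RV P >-> bool}.

Definition mx_of_rows (f : {ffun 'I_m -> {ffun 'I_n -> bool}}) :
  'M[bool]_(m, n) := \matrix_(i, j) f i j.

(** The event is a finite disjoint union of atoms, one per matrix satisfying [A]. Atoms are
    measurable, so [A] may be arbitrary, and independence gives each atom the product of its entry
    weights. *)
Lemma probability_random_matrix (p : R) (A : 'M[bool]_(m, n) -> Prop) :
  0 <= p <= 1 -> iid_bernoulli X p ->
  P [set w | A (random_matrix X w)]
    = (prod_mean (row_weight p) (fun f => `[< A (mx_of_rows f) >]%:R))%:E.
Proof.
move=> p01 [indep law].
(* The atom on which the random matrix has rows [f], written entry by entry to fit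
   [mutually_independent]. *)
pose E (f : {ffun 'I_m -> {ffun 'I_n -> bool}}) : set T :=
  [set w | forall ij, ij \in [set: 'I_m * 'I_n]%SET ->
     [set f ij.1 ij.2] (X ij w)].
have EX f w : E f w -> mx_of_rows f = random_matrix X w.
  by move=> Ew; apply/matrixP => i j; rewrite !mxE (Ew (i, j)).
have PE f : P (E f) = (\prod_i row_weight p (f i))%:E.
  rewrite (indep [set: 'I_m * 'I_n]%SET (fun ij => [set f ij.1 ij.2]))//.
  transitivity (\prod_(ij : 'I_m * 'I_n)
      (bernoulli_pmf p (f ij.1 ij.2))%:E)%E.
    apply: eq_big => [ij|ij _]; first by rewrite inE.
    rewrite -[LHS]/(distribution P (X ij) [set f ij.1 ij.2]) law.
    rewrite bernoulli_probE// !diracE !in_set1.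
    by case: (f _ _); rewrite /bernoulli_pmf /= ?mule1 ?mule0 ?adde0 ?add0e.
  rewrite prodEFin; congr (_%:E).
  by rewrite -(pair_big predT predT (fun i j => bernoulli_pmf p (f i j))).
have mE f : measurable (E f).
  rewrite [E f](_ : _ = \bigcap_(ij in [set: 'I_m * 'I_n])
      (X ij @^-1` [set f ij.1 ij.2])).
    by apply: fin_bigcap_measurable => // ij _; exact: measurable_funPTI.
  by apply/seteqP; split=> w /= Ew ij _; apply: Ew.
pose s := [seq f <- index_enum {ffun 'I_m -> {ffun 'I_n -> bool}} |
  `[< A (mx_of_rows f) >]].
have sP f : f \in s <-> A (mx_of_rows f).
  by rewrite mem_filter mem_index_enum andbT; split=> /asboolP.
rewrite [X in P X](_ : _ = \bigcup_(f in [set` s]) E f).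
  rewrite measure_fin_bigcup//; last first.
    move=> f g _ _ [w [fw gw]].
    apply/ffunP => i; apply/ffunP => j.
    have := congr1 (fun M : 'M[bool]_(m, n) => M i j) (EX _ _ fw).
    by rewrite -(EX _ _ gw) !mxE.
  rewrite -fsbig_seq ?filter_uniq ?index_enum_uniq// big_filter big_mkcond/=.
  rewrite /prod_mean -sumEFin; apply: eq_bigr => f _; rewrite PE.
  by case: asboolP; rewrite ?mulr1 ?mulr0.
apply/seteqP; split=> [w Aw|w [f /sP Af /EX fw]]; last by rewrite /= -fw.
pose f := [ffun i => [ffun j => X (i, j) w]].
have Ef : E f w by case=> i j _ /=; rewrite !ffunE.
by exists f => //; apply/sP; rewrite (EX _ _ Ef).
Qed.

End Law.

(** Each coordinate other than [i] contributes a factor [\sum_k w k = 1]. *)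
Lemma prod_mean_marginal {R : realFieldType} (I K : finType) (w : K -> R)
    (i : I) (g : K -> R) :
  \sum_k w k = 1 ->
  prod_mean w (fun f : {ffun I -> K} => g (f i)) = \sum_k w k * g k.
Proof.
move=> w1.
rewrite (@eq_prod_mean _ _ _ w _
  (fun f : {ffun I -> K} => \prod_i' (if i' == i then g (f i') else 1))).
  rewrite (prod_mean_prod w (fun i' k => if i' == i then g k else 1)).
  rewrite (bigD1 i)//= [X in _ * X]big1 ?mulr1//.
    by apply: eq_bigr => k _; rewrite eqxx.
  move=> i' /negbTE ->.
  by rewrite -[RHS]w1; apply: eq_bigr => k _; rewrite mulr1.
by move=> f; rewrite -big_mkcond big_pred1_eq.
Qed.

(** * Exponential inequalities and Chernoff bounds for counts *)

Section Exponential.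
Context {R : realType}.

(* The inequality is [1 - x / 2 <= expR (- x / 2)], squared and inverted. *)
Lemma expR_le_quadratic (x : R) : x <= 1 / 4 -> expR x <= 1 + x + x ^+ 2.
Proof.
move=> x4; have := expR_ge1Dx (- (x / 2)).
have e1 : expR x * expR (- (x / 2)) ^+ 2 = 1.
  rewrite expr2 -!expRD [X in expR X](_ : _ = 0) ?expR0//; lra.
set y := expR (- (x / 2)) in e1 *; move=> xy.
have y2 : (1 - x / 2) ^+ 2 <= y ^+ 2.
  by rewrite lerXn2r ?nnegrE//; lra.
have h : 1 <= (1 - x / 2) ^+ 2 * (1 + x + x ^+ 2).
  (* For [x <= 1 / 4] the last factor is at least [1 / 4]. *)
  rewrite [leRHS](_ : _ = 1 + x ^+ 2 / 4 * (1 - 3 * x + x ^+ 2)); last by field.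
  have := sqr_ge0 x; nra.
have e0 := expR_gt0 x.
have q0 : 0 <= 1 + x + x ^+ 2 by nra.
have : expR x * (1 - x / 2) ^+ 2 <= (1 - x / 2) ^+ 2 * (1 + x + x ^+ 2).
  by apply: le_trans h; rewrite -[leRHS]e1 ler_wpM2l// ltW.
by rewrite mulrC ler_pM2l// exprn_gt0//; lra.
Qed.

Lemma exprDn_le_expR (x : R) (N : nat) :
  -1 <= x -> (1 + x) ^+ N <= expR (N%:R * x).
Proof.
move=> x1; rewrite expRM_natl; apply: lerXn2r.
- by rewrite nnegrE; lra.
- by rewrite nnegrE expR_ge0.
- exact: expR_ge1Dx.
Qed.

Lemma sum_nonempty_sets_le (J : finType) (x : R) :
  0 <= x -> #|J|%:R * x <= 1 / 4 ->
  \sum_(S : {set J} | S != finset.set0) x ^+ #|S| <= 2 * (#|J|%:R * x).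
Proof.
move=> x0 Jx.
have total : \sum_(S : {set J}) x ^+ #|S| = (1 + x) ^+ #|J|.
  have := @bigA_distr R 0 1 *%R +%R J (fun=> x) (fun=> 1).
  rewrite prodr_const addrC => ->; apply: eq_bigr => S _.
  by rewrite -big_mkcond prodr_const.
rewrite (bigD1 finset.set0)//= cards0 expr0 in total.
(* With [y = #|J| * x <= 1 / 4], the total is at most [1 + y + y ^+ 2]; removing the empty set
   leaves [y + y ^+ 2 <= 2 * y]. *)
have := le_trans (exprDn_le_expR #|J| (le_trans (lerN10 R) x0))
  (expR_le_quadratic Jx).
rewrite -total.
have := mulr_ge0 (ler0n R #|J|) x0.
set y := _%:R * x in Jx *; set z := \sum_(_ | _) _; move: z => z.
nra.
Qed.

(** The count is a sum of independent indicators of mean [q], so its exponential moment is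
    [(1 + q * (expR t - 1)) ^+ #|I|], and [1 + x <= expR x] applies. Both signs of [t] are allowed,
    which serves both tails. *)
Lemma exp_count_le (I K : finType) (w : K -> R) (h : pred K) (t : R) :
  (forall k, 0 <= w k) -> \sum_k w k = 1 ->
  prod_mean w (fun f : {ffun I -> K} =>
      expR (t * #|[set i | h (f i)]%SET|%:R))
    <= expR (#|I|%:R * (\sum_k w k * (h k)%:R) * (expR t - 1)).
Proof.
move=> w0 w1.
set q := \sum_k _.
have q01 : 0 <= q <= 1.
  apply/andP; split; first by apply: sumr_ge0 => k _; rewrite mulr_ge0.
  by rewrite -w1; apply: ler_sum => k _; rewrite ler_piMr// lern1 leq_b1.
rewrite (@eq_prod_mean _ _ _ w _
  (fun f : {ffun I -> K} => \prod_i (if h (f i) then expR t else 1))).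
  rewrite (prod_mean_prod w (fun i k => if h k then expR t else 1)).
  rewrite prodr_const -mulrA.
  rewrite (_ : \sum_k _ = 1 + q * (expR t - 1)).
    by apply: exprDn_le_expR; have := expR_gt0 t; nra.
  rewrite mulr_suml -[X in X + _]w1 -big_split; apply: eq_bigr => k _ /=.
  by case: (h k) => /=; ring.
move=> f; rewrite mulrC expRM_natl -prodr_const [LHS]big_mkcond.
by apply: eq_bigr => i _; rewrite inE.
Qed.

(** With [t = eps / 4] the exponent is at most [mu * (t + t ^+ 2) - t * (1 + 4 * t) * mu], which
    equals [- 3 * t ^+ 2 * mu]. *)
Lemma upper_tail_le (I K : finType) (w : K -> R) (h : pred K) (eps mu : R) :
  (forall k, 0 <= w k) -> \sum_k w k = 1 -> 0 < eps -> eps < 1 -> 0 <= mu ->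
  #|I|%:R * (\sum_k w k * (h k)%:R) = mu ->
  prod_mean w (fun f : {ffun I -> K} =>
      expR (eps / 4 * (#|[set i | h (f i)]%SET|%:R - (1 + eps) * mu)))
    <= expR (- (3 / 16 * eps ^+ 2 * mu)).
Proof.
move=> w0 w1 eps0 eps1 mu0; set q := \sum_k w k * _ => qmu.
rewrite (@eq_prod_mean _ _ _ w _ (fun f : {ffun I -> K} =>
  expR (- (eps / 4 * ((1 + eps) * mu))) *
  expR (eps / 4 * #|[set i | h (f i)]%SET|%:R))); last first.
  by move=> f; rewrite -expRD; congr expR; ring.
rewrite prod_meanZ.
apply: le_trans (ler_wpM2l (expR_ge0 _) (exp_count_le I h (eps / 4) w0 w1)) _.
rewrite -/q qmu -expRD ler_expR.
have e4 : eps / 4 <= 1 / 4 by lra.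
have := ler_wpM2l mu0 (expR_le_quadratic e4).
set E := expR _; set t := eps / 4.
have -> : eps = 4 * t by rewrite /t; field.
lra.
Qed.

(** The mean may fall short of [mu] by a factor [1 - eps / 4]: this absorbs the overlaps between
    columns in [N(S)]. With [t = eps / 4] the exponent is then at most
    [- (2 * t ^+ 2 + t ^+ 3) * mu]. *)
Lemma lower_tail_le (I K : finType) (w : K -> R) (h : pred K) (eps mu : R) :
  (forall k, 0 <= w k) -> \sum_k w k = 1 -> 0 < eps -> eps < 1 -> 0 <= mu ->
  (1 - eps / 4) * mu <= #|I|%:R * (\sum_k w k * (h k)%:R) ->
  prod_mean w (fun f : {ffun I -> K} =>
      expR (- (eps / 4) * (#|[set i | h (f i)]%SET|%:R - (1 - eps) * mu)))
    <= expR (- (1 / 8 * eps ^+ 2 * mu)).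
Proof.
move=> w0 w1 eps0 eps1 mu0; set q := \sum_k w k * _ => qmu.
rewrite (@eq_prod_mean _ _ _ w _ (fun f : {ffun I -> K} =>
  expR (eps / 4 * ((1 - eps) * mu)) *
  expR (- (eps / 4) * #|[set i | h (f i)]%SET|%:R))); last first.
  by move=> f; rewrite -expRD; congr expR; ring.
rewrite prod_meanZ.
apply: le_trans
  (ler_wpM2l (expR_ge0 _) (exp_count_le I h (- (eps / 4)) w0 w1)) _.
rewrite -/q -expRD ler_expR.
have e4 : - (eps / 4) <= 1 / 4 by lra.
have := expR_le_quadratic e4.
set E := expR _; set t := eps / 4 => Et.
have -> : eps = 4 * t by rewrite /t; field.
have t0 : 0 < t by rewrite /t; lra.
have t1 : t < 1 / 4 by rewrite /t; lra.
(* Since [- t + t ^+ 2] is negative, the lower bound on the mean becomes an upper bound here. *)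
have : #|I|%:R * q * (E - 1) <= (1 - t) * mu * (- t + t ^+ 2).
  apply: (@le_trans _ _ (#|I|%:R * q * (- t + t ^+ 2))).
    rewrite ler_wpM2l//; last by lra.
    by apply: le_trans qmu; rewrite mulr_ge0//; lra.
  rewrite ler_wnM2r//; nra.
have := mulr_ge0 mu0 (exprn_ge0 3 (ltW t0)).
lra.
Qed.

End Exponential.

(** * Neighbourhoods in terms of rows, and the chance that a row meets given sets *)

Section Matrix.
Context {R : realType} {m n : nat}.
Implicit Types (f : {ffun 'I_m -> {ffun 'I_n -> bool}}) (S T : {set 'I_n}).

Lemma eq_nbhd_mx_of_rows f S :
  eq_nbhd (mx_of_rows f) S = [set i | [exists j in S, f i j]]%SET.
Proof.
apply/setP => i; rewrite !inE.
by apply: eq_existsb => j; rewrite mxE.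
Qed.

Lemma eq_nbhdI_mx_of_rows f S T :
  (eq_nbhd (mx_of_rows f) S :&: eq_nbhd (mx_of_rows f) T)%SET
    = [set i | [exists j in S, f i j] && [exists j in T, f i j]]%SET.
Proof. by rewrite !eq_nbhd_mx_of_rows; apply/setP => i; rewrite !inE. Qed.

Lemma coord_nbhd1_mx_of_rows f i :
  coord_nbhd (mx_of_rows f) [set i]%SET = [set j | f i j]%SET.
Proof.
apply/setP => j; rewrite !inE; apply/exists_inP/idP => [[i']|fij].
  by rewrite inE => /eqP ->; rewrite mxE.
by exists i; rewrite ?inE// mxE.
Qed.

Lemma eq_nbhd0 (M : 'M[bool]_(m, n)) :
  eq_nbhd M finset.set0 = finset.set0.
Proof.
by apply/setP => i; rewrite !inE; apply/exists_inP => -[j]; rewrite inE.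
Qed.

Variable p : R.
Hypothesis p01 : 0 <= p <= 1.

Lemma row_mean_hit S :
  \sum_r row_weight p r * [exists j in S, r j]%:R = 1 - (1 - p) ^+ #|S|.
Proof.
rewrite -(row_mean_miss p S) -[X in _ = X - _](@sum_row_weight R 'I_n p).
rewrite -sumrB; apply: eq_bigr => r _.
by rewrite -[X in X - _]mulr1 -mulrBr; case: [exists _ in _, _];
  rewrite ?subr0 ?subrr.
Qed.

(** Union bound over pairs in [S] and [T]: disjointness makes the two coordinates distinct, so each
    pair costs [p ^+ 2]. *)
Lemma row_mean_hit2_le S T : [disjoint S & T]%B ->
  \sum_r row_weight p r * ([exists j in S, r j] && [exists j in T, r j])%:R
    <= #|S|%:R * #|T|%:R * p ^+ 2.
Proof.
move=> dST.
apply: (@le_trans _ _ (\sum_(j in S) \sum_(j' in T)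
    \sum_r row_weight p r * [forall l in [set j; j']%SET, r l]%:R)); last first.
  rewrite le_eqVlt; apply/orP; left; apply/eqP.
  rewrite (eq_bigr (fun=> #|T|%:R * p ^+ 2)).
    by rewrite sumr_const -[LHS]mulr_natl mulrA.
  move=> j jS; rewrite (eq_bigr (fun=> p ^+ 2)).
    by rewrite sumr_const mulr_natl.
  move=> j' jT; rewrite row_mean_entries cards2.
  case: eqP => // jj'; rewrite jj' in jS.
  by have := disjointFr dST jS; rewrite jT.
under [leRHS]eq_bigr do rewrite exchange_big.
rewrite [leRHS]exchange_big; apply: ler_sum => r _ /=.
have w0 := row_weight_ge0 p01 r.
case: (boolP (_ && _)) => [/andP[]|_]; last first.
  rewrite mulr0; apply: sumr_ge0 => j _; apply: sumr_ge0 => j' _.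
  by rewrite mulr_ge0.
move=> /exists_inP[j jS rj] /exists_inP[j' jT rj'].
(* The single pair [(j, j')] already contributes the whole weight of [r]. *)
rewrite (bigD1 j)//= (bigD1 j')//=.
have -> : [forall l in [set j; j']%SET, r l].
  by apply/forall_inP => l; rewrite !inE => /orP[] /eqP ->.
rewrite -addrA lerDl addr_ge0//; apply: sumr_ge0 => l _.
  by rewrite mulr_ge0.
by apply: sumr_ge0 => l' _; rewrite mulr_ge0.
Qed.

End Matrix.

(** * Exponential moments of the four kinds of failure *)

Section ExponentialMoments.
Context {R : realType} {m n : nat}.
Implicit Types (f : {ffun 'I_m -> {ffun 'I_n -> bool}}) (S T : {set 'I_n}).

Lemma mean_column_degree_le (p eps : R) (j : 'I_n) :
  0 <= p <= 1 -> 0 < eps -> eps < 1 ->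
  prod_mean (row_weight p) (fun f => expR (eps / 4 *
    (#|eq_nbhd (mx_of_rows f) [set j]%SET|%:R - (1 + eps) * (m%:R * p))))
  <= expR (- (3 / 16 * eps ^+ 2 * (m%:R * p))).
Proof.
move=> p01 eps0 eps1.
pose h (r : {ffun 'I_n -> bool}) := [exists j' in [set j]%SET, r j'].
rewrite (@eq_prod_mean _ _ _ _ _ (fun f => expR (eps / 4 *
    (#|[set i | h (f i)]%SET|%:R - (1 + eps) * (m%:R * p))))); last first.
  by move=> f; rewrite eq_nbhd_mx_of_rows.
apply: upper_tail_le => //.
- exact: row_weight_ge0 p01.
- exact: sum_row_weight.
- by rewrite mulr_ge0//; case/andP: p01.
- by rewrite card_ord row_mean_hit cards1 expr1; ring.
Qed.

(** Only row [i] matters, so the mean reduces to that row, whose entries then play the part of the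
    independent coordinates. *)
Lemma mean_row_degree_le (p eps : R) (i : 'I_m) :
  0 <= p <= 1 -> 0 < eps -> eps < 1 ->
  prod_mean (row_weight p) (fun f => expR (eps / 4 *
    (#|coord_nbhd (mx_of_rows f) [set i]%SET|%:R - (1 + eps) * (n%:R * p))))
  <= expR (- (3 / 16 * eps ^+ 2 * (n%:R * p))).
Proof.
move=> p01 eps0 eps1.
pose g (r : {ffun 'I_n -> bool}) :=
  expR (eps / 4 * (#|[set j | r j]%SET|%:R - (1 + eps) * (n%:R * p))).
rewrite (@eq_prod_mean _ _ _ _ _ (fun f => g (f i))); last first.
  by move=> f; rewrite coord_nbhd1_mx_of_rows.
rewrite (prod_mean_marginal i g (sum_row_weight p)).
rewrite -[leLHS]/(prod_mean (bernoulli_pmf p) (fun r : {ffun 'I_n -> bool} =>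
  expR (eps / 4 * (#|[set j | id (r j)]%SET|%:R - (1 + eps) * (n%:R * p))))).
apply: upper_tail_le => //.
- by move=> b; exact: bernoulli_pmf_ge0.
- by rewrite big_bool /bernoulli_pmf /= addrC subrK.
- by rewrite mulr_ge0//; case/andP: p01.
- by rewrite card_ord big_bool /bernoulli_pmf /= mulr1 mulr0 addr0.
Qed.

(** With [y = p * #|S|], a row meets [S] with probability at least [y * (1 - y)]; as [y <= eps / 4],
    this is within the slack of [lower_tail_le]. *)
Lemma mean_expansion_le (p eps : R) S :
  0 <= p <= 1 -> 0 < eps -> eps < 1 -> p * #|S|%:R <= eps / 4 ->
  prod_mean (row_weight p) (fun f => expR (- (eps / 4) *
    (#|eq_nbhd (mx_of_rows f) S|%:R - (1 - eps) * (m%:R * p * #|S|%:R))))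
  <= expR (- (1 / 8 * eps ^+ 2 * (m%:R * p * #|S|%:R))).
Proof.
move=> p01 eps0 eps1 pS; have /andP[p0 p1] := p01.
pose h (r : {ffun 'I_n -> bool}) := [exists j in S, r j].
rewrite (@eq_prod_mean _ _ _ _ _ (fun f => expR (- (eps / 4) *
    (#|[set i | h (f i)]%SET|%:R - (1 - eps) * (m%:R * p * #|S|%:R)))));
  last by move=> f; rewrite eq_nbhd_mx_of_rows.
apply: lower_tail_le => //.
- exact: row_weight_ge0 p01.
- exact: sum_row_weight.
- by rewrite !mulr_ge0.
rewrite card_ord row_mean_hit -mulrA mulrCA ler_wpM2l//.
have y0 : 0 <= p * #|S|%:R by rewrite mulr_ge0.
have : (1 - p) ^+ #|S| <= 1 + - (p * #|S|%:R) + (p * #|S|%:R) ^+ 2.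
  apply: (@le_trans _ _ (expR (#|S|%:R * - p))).
    by apply: exprDn_le_expR; lra.
  rewrite mulrN mulrC -[X in _ + X]sqrrN; apply: expR_le_quadratic; lra.
have := ler_wpM2l y0 pS; lra.
Qed.

(** Here [l] stays free because the deviation is far above the mean; the choice [l = ln d] later
    turns [expR l] into [d]. *)
Lemma mean_intersection_le (p l c : R) S T :
  0 <= p <= 1 -> 0 <= l -> [disjoint S & T]%B ->
  prod_mean (row_weight p) (fun f => expR (l *
    (#|(eq_nbhd (mx_of_rows f) S :&: eq_nbhd (mx_of_rows f) T)%SET|%:R - c)))
  <= expR (m%:R * (#|S|%:R * #|T|%:R * p ^+ 2) * expR l - l * c).
Proof.
move=> p01 l0 dST.
pose h (r : {ffun 'I_n -> bool}) :=
  [exists j in S, r j] && [exists j in T, r j].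
rewrite (@eq_prod_mean _ _ _ _ _ (fun f => expR (- (l * c)) *
    expR (l * #|[set i | h (f i)]%SET|%:R))); last first.
  by move=> f; rewrite eq_nbhdI_mx_of_rows -expRD; congr expR; ring.
rewrite prod_meanZ.
apply: (le_trans (ler_wpM2l (expR_ge0 _) (exp_count_le _ _ _ _ _))).
- exact: row_weight_ge0 p01.
- exact: sum_row_weight.
rewrite -expRD ler_expR addrC lerD2r card_ord.
have l1 : 1 <= expR l by rewrite -expR0 ler_expR.
apply: (@le_trans _ _ (m%:R * (#|S|%:R * #|T|%:R * p ^+ 2) * (expR l - 1))).
  by rewrite ler_wpM2r ?subr_ge0// ler_wpM2l// row_mean_hit2_le.
rewrite ler_wpM2l//; last by lra.
by have /andP[p0 _] := p01; rewrite !mulr_ge0.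
Qed.

End ExponentialMoments.

(** * Union bound through a total failure weight *)

Lemma term_le_sum {R : numDomainType} (I : finType) (Q : pred I) (F : I -> R)
    (i : I) :
  (forall j, Q j -> 0 <= F j) -> Q i -> F i <= \sum_(j | Q j) F j.
Proof.
move=> F0 Qi; rewrite (bigD1 i)//= lerDl.
by apply: sumr_ge0 => j /andP[Qj _]; exact: F0.
Qed.

(** The empty set would contribute [x ^+ 0 = 1] to the union bound, so it is excluded and its bounds
    are checked directly. *)
Definition small_nonempty (R : numDomainType) (n : nat) (k : R) :
  pred {set 'I_n} :=
  [pred S | (S != finset.set0) && (#|S|%:R <= k)].

Section Failure.
Context {R : realType} {m n : nat}.
Implicit Types f : {ffun 'I_m -> {ffun 'I_n -> bool}}.

(* Each summand is at least 1 when the corresponding bound fails. *)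
Definition failure_weight (d : nat) (eps l k : R) f : R :=
  \sum_(j : 'I_n) expR (eps / 4 *
    (#|eq_nbhd (mx_of_rows f) [set j]%SET|%:R - (1 + eps) * d%:R))
  + \sum_(i : 'I_m) expR (eps / 4 *
    (#|coord_nbhd (mx_of_rows f) [set i]%SET|%:R
      - (1 + eps) * (n%:R / m%:R) * d%:R))
  + \sum_(S | small_nonempty k S) expR (- (eps / 4) *
    (#|eq_nbhd (mx_of_rows f) S|%:R - (1 - eps) * d%:R * #|S|%:R))
  + \sum_(S | small_nonempty k S)
      \sum_(T : {set 'I_n} | small_nonempty k T && [disjoint S & T]%B) expR (l *
    (#|(eq_nbhd (mx_of_rows f) S :&: eq_nbhd (mx_of_rows f) T)%SET|%:R
      - Num.sqrt (d%:R : R) / 8 * (maxn #|S| #|T|)%:R)).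

Lemma failure_weight_ge0 (d : nat) (eps l k : R) f :
  0 <= failure_weight d eps l k f.
Proof.
by rewrite !addr_ge0//; repeat (apply: sumr_ge0 => ? _); exact: expR_ge0.
Qed.

(** All terms are nonnegative, so each is below 1 and its exponent is negative, which is the desired
    bound. *)
Lemma failure_weight_lt1 (d : nat) (eps l k : R) f :
  0 < eps -> 0 < l -> failure_weight d eps l k f < 1 ->
  [/\ degrees_bounded (mx_of_rows f) d eps, expanding (mx_of_rows f) d eps k &
      small_intersections (mx_of_rows f) d k].
Proof.
move=> eps0 l0; rewrite /failure_weight.
set a := \sum_(j < n) _; set b := \sum_(i < m) _.
set e := \sum_(S | _) _; set c := \sum_(S | _) _ => abce.
have a0 : 0 <= a by apply: sumr_ge0 => *; exact: expR_ge0.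
have b0 : 0 <= b by apply: sumr_ge0 => *; exact: expR_ge0.
have c0 : 0 <= c by apply: sumr_ge0 => S _; exact: expR_ge0.
have e0 : 0 <= e.
  by apply: sumr_ge0 => S _; apply: sumr_ge0 => T _; exact: expR_ge0.
have eps4 : 0 < eps / 4 by lra.
split; first split.
- move=> j; apply: ltW; rewrite -subr_lt0 -(pmulr_rlt0 _ eps4) -expR_lt1.
  apply: (@le_lt_trans _ _ a); last by lra.
  by apply: (term_le_sum (i := j)) => // j' _; exact: expR_ge0.
- move=> i; apply: ltW; rewrite -subr_lt0 -(pmulr_rlt0 _ eps4) -expR_lt1.
  apply: (@le_lt_trans _ _ b); last by lra.
  by apply: (term_le_sum (i := i)) => // i' _; exact: expR_ge0.
- move=> S Sk; have [->|S0] := eqVneq S finset.set0.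
    by rewrite eq_nbhd0 !cards0 mulr0.
  rewrite ltW// -subr_gt0 -(pmulr_rgt0 _ eps4) -oppr_lt0 -mulNr -expR_lt1.
  apply: (@le_lt_trans _ _ c); last by lra.
  apply: (term_le_sum (i := S)) => [S' _|]; first exact: expR_ge0.
  by rewrite /small_nonempty /= S0.
- move=> S T dST Sk Tk.
  have rhs0 : 0 <= Num.sqrt (d%:R : R) / 8 * (maxn #|S| #|T|)%:R.
    by rewrite mulr_ge0// divr_ge0// sqrtr_ge0.
  have [S0|S0] := eqVneq S finset.set0.
    by rewrite S0 eq_nbhd0 finset.set0I cards0 -S0.
  have [T0|T0] := eqVneq T finset.set0.
    by rewrite T0 eq_nbhd0 finset.setI0 cards0 -T0.
  rewrite ltW// -subr_lt0 -(pmulr_rlt0 _ l0) -expR_lt1.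
  apply: (@le_lt_trans _ _ e); last by lra.
  apply: (le_trans _ (term_le_sum (i := S) _ _)) => [|S' _|]; last 1 first.
  + by rewrite /small_nonempty /= S0.
  + apply: (term_le_sum (i := T)) => [T' _|]; first exact: expR_ge0.
    by rewrite /small_nonempty /= T0 Tk dST.
  + by apply: sumr_ge0 => *; exact: expR_ge0.
Qed.

End Failure.

(** * Numerical estimates for the expected failure weight *)

Lemma intersection_exponent_le {R : realFieldType} (m d l L q s t r : R) :
  0 < m -> 1 <= d -> 0 <= L -> 1 <= q -> L <= q -> 72 <= l ->
  0 <= r -> s <= r -> t <= r -> s * t <= r * (m / d ^+ 3) ->
  m * (s * t * (d / m) ^+ 2) * d - l * (q / 8 * r) <= - (4 * L) * s - 4 * L * t.
Proof.
move=> m0 d1 L0 q1 Lq l72 r0 sr tr strk.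
(* In the application [s] and [t] are the set sizes, [r] their maximum, [q] is [sqrt d] and [l] is
   [ln d]. The first term is [s * t / k] with [k = m / d ^+ 3], hence at most [r]. *)
have -> : m * (s * t * (d / m) ^+ 2) * d = s * t / (m / d ^+ 3).
  by field; rewrite !gt_eqF//; lra.
have k0 : 0 < m / d ^+ 3 by rewrite divr_gt0// exprn_gt0//; lra.
have h1 : s * t / (m / d ^+ 3) <= r by rewrite ler_pdivrMr.
(* [72 = 8 * (1 + 4 + 4)]: the gain [9 * q * r] pays for [r], [4 * L * s] and [4 * L * t]. *)
have h2 : 72 * (q / 8 * r) <= l * (q / 8 * r).
  by rewrite ler_wpM2r// mulr_ge0//; lra.
have h3 : L * s <= q * r.
  by apply: (@le_trans _ _ (L * r)); [rewrite ler_wpM2l|rewrite ler_wpM2r].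
have h4 : L * t <= q * r.
  by apply: (@le_trans _ _ (L * r)); [rewrite ler_wpM2l|rewrite ler_wpM2r].
have h5 : r <= q * r by rewrite ler_peMl.
lra.
Qed.

(** With [x = 1 / n], the four sums are at most [x ^+ 5], [x ^+ 5], [2 * x ^+ 3] and
    [(2 * x ^+ 3) ^+ 2], each at most [x]. *)
Lemma mean_failure_weight_le (R : realType) (m n d : nat) (eps : R) :
  let L : R := ln n%:R in
  (d <= m)%N -> (m <= n)%N -> 0 < eps -> eps < 1 ->
  3 <= L -> 32 * L <= eps ^+ 2 * d%:R -> L ^+ 2 <= d%:R ->
  72 <= ln (d%:R : R) ->
  prod_mean (row_weight (d%:R / m%:R))
    (@failure_weight R m n d eps (ln d%:R) (m%:R / d%:R ^+ 3))
  <= 4 / n%:R.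
Proof.
move=> L dm mn eps0 eps1 L3 epsd Ld lnd.
have d32 : 32 <= d%:R :> R by nra.
have dmR : d%:R <= m%:R :> R by rewrite ler_nat.
have mnR : m%:R <= n%:R :> R by rewrite ler_nat.
have m0 : 0 < m%:R :> R by lra.
have n0 : 0 < n%:R :> R by lra.
set p := d%:R / m%:R; set k := m%:R / d%:R ^+ 3.
have p01 : 0 <= p <= 1.
  by rewrite /p divr_ge0//= ler_pdivrMr ?mul1r.
have mp : m%:R * p = d%:R by rewrite /p; field; rewrite gt_eqF.
have dnp : d%:R <= n%:R * p.
  by rewrite -mp ler_wpM2r//; case/andP: p01.
pose x : R := expR (- L).
have xE : x = n%:R^-1 by rewrite /x expRN lnK ?posrE.
have xn : n%:R * x = 1 by rewrite xE divff// gt_eqF.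
have x0 : 0 < x := expR_gt0 _.
have x4 : x <= 1 / 4.
  rewrite /x expRN div1r lef_pV2 ?posrE ?expR_gt0//.
  by apply: le_trans (expR_ge1Dx _); lra.
rewrite -xE.
have xX i : expR (- (i%:R * L)) = x ^+ i by rewrite -expRM_natl mulrN.
have sum_x : \sum_(S : {set 'I_n} | small_nonempty k S) (x ^+ 4) ^+ #|S|
    <= 2 * x ^+ 3.
  have nx : #|'I_n|%:R * x ^+ 4 = x ^+ 3.
    by rewrite card_ord exprS mulrA xn mul1r.
  rewrite -nx.
  apply: le_trans (sum_nonempty_sets_le _ _); last 2 first.
  - by rewrite exprn_ge0// ltW.
  - by rewrite nx; nra.
  rewrite [leLHS]big_mkcond [leRHS]big_mkcond; apply: ler_sum => S _.
  rewrite /small_nonempty /=; case: (_ != _) => //=; case: ifP => // _.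
  by rewrite !exprn_ge0// ltW.
rewrite /failure_weight !prod_meanD !prod_mean_sum.
have cols : \sum_(j < n) prod_mean (row_weight p)
    (fun f : {ffun 'I_m -> {ffun 'I_n -> bool}} => expR (eps / 4 *
      (#|eq_nbhd (mx_of_rows f) [set j]%SET|%:R - (1 + eps) * d%:R))) <= x ^+ 5.
  apply: (@le_trans _ _ (\sum_(j < n) x ^+ 6)); last first.
    by rewrite sumr_const card_ord -[leLHS]mulr_natl exprS mulrA xn mul1r.
  apply: ler_sum => j _.
  have := @mean_column_degree_le R m n p eps j p01 eps0 eps1.
  rewrite mp => /le_trans; apply.
  (* [3 / 16 * 32 = 6], so the exponent is at most [- 6 * L]. *)
  rewrite -xX ler_expR; lra.
have rows : \sum_(i < m) prod_mean (row_weight p)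
    (fun f : {ffun 'I_m -> {ffun 'I_n -> bool}} => expR (eps / 4 *
      (#|coord_nbhd (mx_of_rows f) [set i]%SET|%:R
        - (1 + eps) * (n%:R / m%:R) * d%:R))) <= x ^+ 5.
  apply: (@le_trans _ _ (\sum_(i < m) x ^+ 6)); last first.
    rewrite sumr_const card_ord -[leLHS]mulr_natl.
    have -> : x ^+ 5 = n%:R * x ^+ 6 by rewrite (exprS _ 5) mulrA xn mul1r.
    by rewrite ler_wpM2r// exprn_ge0// ltW.
  apply: ler_sum => i _.
  have := @mean_row_degree_le R m n p eps i p01 eps0 eps1.
  have -> : (1 + eps) * (n%:R * p) = (1 + eps) * (n%:R / m%:R) * d%:R.
    by rewrite /p; field; rewrite gt_eqF.
  move=> /le_trans; apply.
  (* The same computation as for columns, since [d <= n * p]. *)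
  by rewrite -xX ler_expR; have := sqr_ge0 eps; nra.
have expansion : \sum_(S : {set 'I_n} | small_nonempty k S)
    prod_mean (row_weight p)
    (fun f : {ffun 'I_m -> {ffun 'I_n -> bool}} => expR (- (eps / 4) *
      (#|eq_nbhd (mx_of_rows f) S|%:R - (1 - eps) * d%:R * #|S|%:R)))
    <= 2 * x ^+ 3.
  apply: le_trans sum_x; apply: ler_sum => S /andP[_ Sk].
  have pS : p * #|S|%:R <= eps / 4.
    have /andP[p0 _] := p01.
    apply: (le_trans (ler_wpM2l p0 Sk)).
    have -> : p * k = (d%:R ^+ 2)^-1.
      by rewrite /p /k; field; rewrite !gt_eqF//; lra.
    (* As [eps < 1], [eps * d >= eps ^+ 2 * d >= 32 * L >= 96]. *)
    have epsd' : 96 <= eps * d%:R by nra.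
    rewrite -div1r ler_pdivrMr ?exprn_gt0//; last by lra.
    nra.
  have := @mean_expansion_le R m n p eps S p01 eps0 eps1 pS.
  rewrite mp mulrA => /le_trans; apply.
  (* [1 / 8 * 32 = 4] gives the exponent [- 4 * L * #|S|]. *)
  rewrite -exprM -xX ler_expR natrM; have := ler0n R #|S|; nra.
have intersections : \sum_(S : {set 'I_n} | small_nonempty k S)
    prod_mean (row_weight p)
      (fun f : {ffun 'I_m -> {ffun 'I_n -> bool}} =>
    \sum_(T : {set 'I_n} | small_nonempty k T && [disjoint S & T]%B)
      expR (ln d%:R *
      (#|(eq_nbhd (mx_of_rows f) S :&: eq_nbhd (mx_of_rows f) T)%SET|%:R
        - Num.sqrt (d%:R : R) / 8 * (maxn #|S| #|T|)%:R)))
    <= (2 * x ^+ 3) ^+ 2.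
  (* Dropping disjointness from the range of [T] makes the double sum a square. *)
  apply: (@le_trans _ _ (\sum_(S : {set 'I_n} | small_nonempty k S)
      \sum_(T : {set 'I_n} | small_nonempty k T)
        (x ^+ 4) ^+ #|S| * (x ^+ 4) ^+ #|T|)); last first.
    under eq_bigr do rewrite -mulr_sumr.
    rewrite -mulr_suml -expr2 lerXn2r ?nnegrE//.
      by apply: sumr_ge0 => S _; rewrite !exprn_ge0// ltW.
    by rewrite mulr_ge0// exprn_ge0// ltW.
  apply: ler_sum => S /andP[_ Sk].
  rewrite prod_mean_sum big_mkcondr; apply: ler_sum => T /andP[_ Tk].
  case: ifPn => [dST|_]; last first.
    by rewrite mulr_ge0// !exprn_ge0// ltW.
  have ld0 : 0 <= ln (d%:R : R) by lra.
  have := @mean_intersection_le R m n p (ln d%:R)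
    (Num.sqrt (d%:R : R) / 8 * (maxn #|S| #|T|)%:R) S T p01 ld0 dST.
  move=> /le_trans; apply.
  rewrite -!exprM -exprD -xX ler_expR natrD !natrM lnK ?posrE; last by lra.
  have Lq : L <= Num.sqrt (d%:R : R).
    rewrite -(ger0_norm (_ : 0 <= L)) -?sqrtr_sqr ?ler_wsqrtr//; lra.
  (* The product is the larger size times the smaller, and the smaller is at most [k]. *)
  have : #|S|%:R * #|T|%:R <= (maxn #|S| #|T|)%:R * k.
    case: (leqP #|S| #|T|) => _; last by rewrite ler_wpM2l.
    by rewrite mulrC ler_wpM2l.
  move=> /(@intersection_exponent_le R m%:R d%:R (ln d%:R) L
    (Num.sqrt (d%:R : R)) #|S|%:R #|T|%:R (maxn #|S| #|T|)%:R m0).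
  rewrite !ler_nat leq_maxl leq_maxr.
  move=> h; apply: le_trans (h _ _ _ _ _ _ _ _) _ => //; lra.
have x5 : x ^+ 5 <= x by rewrite exprS ger_pMr// exprn_ile1//; lra.
have x3 : 2 * x ^+ 3 <= x by nra.
have x6 : (2 * x ^+ 3) ^+ 2 <= x by nra.
lra.
Qed.

Theorem theorem4p14 (R : realType) :
  exists n0 : nat, forall n : nat, (n0 <= n)%N -> (0 < n)%N -> ~~ odd n ->
  forall (m d : nat) (eps : R),
    (d <= m)%N -> (m <= n)%N -> 0 < eps -> eps < 1 ->
    32 * eps ^- 2 * ln (n%:R : R) <= d%:R ->
    (ln (n%:R : R)) ^+ 2 <= d%:R ->
  forall (dT : measure_display) (T : measurableType dT) (P : probability T R)
    (X : 'I_m * 'I_n -> {RV P >-> bool}),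
    iid_bernoulli X (d%:R / m%:R) ->
    let k : R := m%:R / d%:R ^+ 3 in
    let M : T -> 'M[bool]_(m, n) := random_matrix X in
    ((1 - 4 / n%:R - 2 / m%:R ^+ 2)%:E
      <= P [set w | [/\ degrees_bounded (M w) d eps,
                        expanding (M w) d eps k &
                        small_intersections (M w) d k]])%E.
Proof.
pose c : R := expR (expR 36).
exists (Num.bound c) => n cn n0 _ m d eps dm mn eps0 eps1 epsd Ld.
move=> dT T P X iid; cbv zeta; set k : R := m%:R / d%:R ^+ 3.
have cnR : c <= n%:R.
  apply: (@le_trans _ _ (Num.bound c)%:R); last by rewrite ler_nat.
  by rewrite ltW// archi_boundP// expR_ge0.
have L36 : expR 36 <= ln n%:R :> R.
  by rewrite -(expRK (expR 36)) ler_ln// posrE ?expR_gt0// ltr0n.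
have L37 : 37 <= ln n%:R :> R.
  by apply: le_trans L36; apply: le_trans (expR_ge1Dx _); lra.
have d0 : 0 < d%:R :> R by apply: lt_le_trans Ld; rewrite exprn_gt0//; lra.
(* [d >= (ln n) ^+ 2 >= (expR 36) ^+ 2 = expR 72]. *)
have lnd : 72 <= ln (d%:R : R).
  apply: (@le_trans _ _ (ln (ln (n%:R : R) ^+ 2))); last first.
    by rewrite ler_ln// posrE exprn_gt0//; lra.
  have -> : 72 = ln (expR 36 ^+ 2) :> R.
    by rewrite -expRM_natl expRK; lra.
  rewrite ler_ln ?posrE ?exprn_gt0 ?expR_gt0//; last by lra.
  by rewrite lerXn2r// nnegrE ?expR_ge0//; lra.
have epsd2 : 32 * ln n%:R <= eps ^+ 2 * d%:R :> R.
  have e2 : 0 < eps ^+ 2 by rewrite exprn_gt0.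
  move: epsd; rewrite mulrAC ler_pdivrMr//; lra.
have m0 : 0 < m%:R :> R by apply: lt_le_trans d0 _; rewrite ler_nat.
have p01 : 0 <= (d%:R / m%:R : R) <= 1.
  by rewrite divr_ge0//= ler_pdivrMr// mul1r ler_nat.
rewrite (probability_random_matrix (fun M => [/\ degrees_bounded M d eps,
  expanding M d eps k & small_intersections M d k]) p01 iid) lee_fin.
have L3 : 3 <= ln n%:R :> R by lra.
have := mean_failure_weight_le dm mn eps0 eps1 L3 epsd2 Ld lnd.
set w := row_weight _ => failure.
have w0 r : 0 <= w r by exact: row_weight_ge0.
have m2 : 0 <= 2 / m%:R ^+ 2 :> R by rewrite divr_ge0// exprn_ge0.
(* Markov's inequality in pointwise form: 1 minus the failure weight is at most the indicator of the
   good event. *)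
apply: (@le_trans _ _ (1 - prod_mean w
    (@failure_weight R m n d eps (ln d%:R) k))); first lra.
rewrite -{1}(@prod_mean1 _ 'I_m _ w (sum_row_weight _)) -prod_meanB.
apply: le_prod_mean => // f; case: asboolP => [_|bad].
  rewrite lerBlDr lerDl; exact: failure_weight_ge0.
rewrite subr_le0 leNgt; apply/negP => lt1; apply: bad.
by apply: failure_weight_lt1 lt1; lra.
Qed.
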